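(* Let $f:\mathbb{R}^{2}\rightarrow \mathbb{R}^{2}$, $f(x,y)=(f_1(x,y),f_2(x,y))$, be an entire (i.e. defined on all of $\mathbb{R}^2$) smooth map such that its graph $$G_f=\{(x,y,f_1(x,y),f_2(x,y))\in\mathbb{R}^4:(x,y)\in\mathbb{R}^2\}$$ is a minimal surface in $\mathbb{R}^4$. If the Jacobian $J_f=\det(df)=\frac{\partial f_1}{\partial x}\frac{\partial f_2}{\partial y}-\frac{\partial f_1}{\partial y}\frac{\partial f_2}{\partial x}$ is bounded on $\mathbb{R}^2$, then $G_f$ is a plane (an affine $2$-plane in $\mathbb{R}^4$).
   Context: Minimal means vanishing mean curvature vector; equivalently $f$ satisfies $(1+|f_y|^2)f_{xx}-2\langle f_x,f_y\rangle f_{xy}+(1+|f_x|^2)f_{yy}=0$. *)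

(* Defs.v *)
From Stdlib Require Import Reals.
From Coquelicot Require Import Coquelicot.
Open Scope R_scope.

Definition dx (g : R -> R -> R) : R -> R -> R :=
  fun x y => Derive (fun t => g t y) x.
Definition dy (g : R -> R -> R) : R -> R -> R :=
  fun x y => Derive (fun t => g x t) y.

Fixpoint Ck (k : nat) (g : R -> R -> R) : Prop :=
  match k with
  | O => forall x y, continuity_2d_pt g x y
  | S k' =>
      (forall x y, continuity_2d_pt g x y) /\
      (forall x y, ex_derive (fun t => g t y) x /\ ex_derive (fun t => g x t) y) /\
      Ck k' (dx g) /\ Ck k' (dy g)
  end.

Definition smooth2 (g : R -> R -> R) : Prop := forall k, Ck k g.

(* The graph of f = (f1,f2) : R^2 -> R^2 is a minimal surface in R^4:
   vanishing mean curvature, equivalently the minimal surface system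
   (1+|f_y|^2) f_xx - 2<f_x,f_y> f_xy + (1+|f_x|^2) f_yy = 0. *)
Definition minimal_graph (f1 f2 : R -> R -> R) : Prop :=
  forall x y,
    let f1x := dx f1 x y in let f1y := dy f1 x y in
    let f2x := dx f2 x y in let f2y := dy f2 x y in
    let A := 1 + (f1y ^ 2 + f2y ^ 2) in
    let B := f1x * f1y + f2x * f2y in
    let C := 1 + (f1x ^ 2 + f2x ^ 2) in
    A * dx (dx f1) x y - 2 * B * dx (dy f1) x y + C * dy (dy f1) x y = 0 /\
    A * dx (dx f2) x y - 2 * B * dx (dy f2) x y + C * dy (dy f2) x y = 0.

Definition jacobian (f1 f2 : R -> R -> R) (x y : R) : R :=
  dx f1 x y * dy f2 x y - dy f1 x y * dx f2 x y.

Definition R4 : Type := (R * R * R * R)%type.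

Definition graph (f1 f2 : R -> R -> R) : R4 -> Prop :=
  fun q => match q with (a, b, c, d) => c = f1 a b /\ d = f2 a b end.

Definition affine_2plane (S : R4 -> Prop) : Prop :=
  exists p1 p2 p3 p4 u1 u2 u3 u4 v1 v2 v3 v4 : R,
    (forall s t, s * u1 + t * v1 = 0 -> s * u2 + t * v2 = 0 ->
                 s * u3 + t * v3 = 0 -> s * u4 + t * v4 = 0 ->
                 s = 0 /\ t = 0) /\
    (forall q : R4, S q <->
       exists s t, q = (p1 + s * u1 + t * v1, p2 + s * u2 + t * v2,
                        p3 + s * u3 + t * v3, p4 + s * u4 + t * v4)).

(* Main.v *)
Require Import Defs.
From Stdlib Require Import Reals Lra FunctionalExtensionality ClassicalEpsilon.
From Coquelicot Require Import Coquelicot.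
Open Scope R_scope.

(* Write p = f_x, q = f_y, W for the area element, and r = (1 + |p|^2) / W,
   s = <p, q> / W, t = (1 + |q|^2) / W, so that r t - s^2 = 1. Minimality gives
   r_y = s_x and s_y = t_x, hence potentials F, G with dF = r dx + s dy and
   dG = s dx + t dy. Lewy's map (x, y) |-> (x + F, y + G) increases distances
   and its components are isothermal for r dx^2 + 2 s dx dy + t dy^2. Comparing
   with a superharmonic function that tends to infinity proves Liouville's
   theorem for this conformal structure: a bounded solution u of
   t u_xx - 2 s u_xy + r u_yy = 0 is constant. Lewy's bounded holomorphic
   function ((t - r) + 2 i s) / (2 + r + t) is therefore constant, so r, s, t are
   constant (Jorgens' theorem). Then W^2 = (r + t) W - 1 + J^2 bounds W, hence
   |f_x| and |f_y|, in terms of the Jacobian J, and Liouville's theorem applied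
   to the components of f_x and f_y shows that they are constant. *)

(** * Calculus of smooth functions of two variables *)

Lemma Ck_pred k g : Ck (S k) g -> Ck k g.
Proof.
revert g; induction k as [|k IH]; intros g [Hc [He [Hx Hy]]]; [exact Hc|].
split; [exact Hc|split; [exact He|split; apply IH; assumption]].
Qed.

Lemma Ck_continuity k g : Ck k g -> forall x y, continuity_2d_pt g x y.
Proof. destruct k; [intros H; exact H|intros [H _]; exact H]. Qed.

(** An equality of functions rather than of values, so that it can be rewritten under a further [dx]
    or [dy]. *)
Lemma dx_is_derive g (g' : R -> R -> R) :
  (forall x y, is_derive (fun t => g t y) x (g' x y)) -> dx g = g'.
Proof.
intros H; do 2 (apply functional_extensionality; intros ?).
now apply is_derive_unique.
Qed.

Lemma dy_is_derive g (g' : R -> R -> R) :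
  (forall x y, is_derive (fun t => g x t) y (g' x y)) -> dy g = g'.
Proof.
intros H; do 2 (apply functional_extensionality; intros ?).
now apply is_derive_unique.
Qed.

Lemma is_derive_dx k g x y :
  Ck (S k) g -> is_derive (fun t => g t y) x (dx g x y).
Proof. intros [_ [H _]]; exact (Derive_correct _ _ (proj1 (H x y))). Qed.

Lemma is_derive_dy k g x y :
  Ck (S k) g -> is_derive (fun t => g x t) y (dy g x y).
Proof. intros [_ [H _]]; exact (Derive_correct _ _ (proj2 (H x y))). Qed.

(** Lets the partial derivatives be supplied in closed form, as the inductions on [k] below
    require. *)
Lemma Ck_intro k g gx gy :
  (forall x y, continuity_2d_pt g x y) ->
  (forall x y, is_derive (fun t => g t y) x (gx x y)) ->
  (forall x y, is_derive (fun t => g x t) y (gy x y)) ->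
  Ck k gx -> Ck k gy -> Ck (S k) g.
Proof.
intros Hc Hx Hy Hgx Hgy; split; [exact Hc|split; [|split]].
- intros x y; split; eexists; [apply Hx|apply Hy].
- now rewrite (dx_is_derive g gx).
- now rewrite (dy_is_derive g gy).
Qed.

Lemma Ck_const k c : Ck k (fun _ _ => c).
Proof.
revert c; induction k as [|k IH]; intros c.
- intros x y; apply continuity_2d_pt_const.
- apply (Ck_intro k _ (fun _ _ => 0) (fun _ _ => 0)); try apply IH;
    intros x y; [apply continuity_2d_pt_const| |]; apply (is_derive_const c).
Qed.

Lemma Ck_plus k g h : Ck k g -> Ck k h -> Ck k (fun x y => g x y + h x y).
Proof.
revert g h; induction k as [|k IH]; intros g h Hg Hh.
- intros x y; apply continuity_2d_pt_plus; [apply Hg|apply Hh].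
- apply (Ck_intro k _ (fun x y => dx g x y + dx h x y)
                      (fun x y => dy g x y + dy h x y)).
  + intros x y; apply continuity_2d_pt_plus;
      eapply Ck_continuity; eassumption.
  + intros x y; apply (is_derive_plus (fun t => g t y) (fun t => h t y));
      eapply is_derive_dx; eassumption.
  + intros x y; apply (is_derive_plus (fun t => g x t) (fun t => h x t));
      eapply is_derive_dy; eassumption.
  + apply IH; [apply Hg|apply Hh].
  + apply IH; [apply Hg|apply Hh].
Qed.

Lemma is_derive_mul (g h : R -> R) x dg dh :
  is_derive g x dg -> is_derive h x dh ->
  is_derive (fun t => g t * h t) x (dg * h x + g x * dh).
Proof.
intros Hg Hh; apply (is_derive_mult (K := R_AbsRing) g h x dg dh Hg Hh).
exact Rmult_comm.
Qed.

Lemma Ck_mult k g h : Ck k g -> Ck k h -> Ck k (fun x y => g x y * h x y).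
Proof.
revert g h; induction k as [|k IH]; intros g h Hg Hh.
- intros x y; apply continuity_2d_pt_mult; [apply Hg|apply Hh].
- apply (Ck_intro k _ (fun x y => dx g x y * h x y + g x y * dx h x y)
                      (fun x y => dy g x y * h x y + g x y * dy h x y)).
  + intros x y; apply continuity_2d_pt_mult;
      eapply Ck_continuity; eassumption.
  + intros x y; apply (is_derive_mul (fun t => g t y) (fun t => h t y));
      eapply is_derive_dx; eassumption.
  + intros x y; apply (is_derive_mul (fun t => g x t) (fun t => h x t));
      eapply is_derive_dy; eassumption.
  + apply Ck_plus; apply IH; (apply Ck_pred; assumption) || apply Hg || apply Hh.
  + apply Ck_plus; apply IH; (apply Ck_pred; assumption) || apply Hg || apply Hh.
Qed.

(** The derivative [- g' / g^2] contains [1 / g] again, but only in class [k], where the induction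
    hypothesis applies. *)
Lemma Ck_inv k g :
  (forall x y, g x y <> 0) -> Ck k g -> Ck k (fun x y => / g x y).
Proof.
intros Hn; induction k as [|k IH]; intros Hg.
- intros x y; apply continuity_2d_pt_inv; [apply Hg|apply Hn].
- assert (Hi := IH (Ck_pred _ _ Hg)).
  apply (Ck_intro k _ (fun x y => (- (1)) * dx g x y * (/ g x y * / g x y))
                      (fun x y => (- (1)) * dy g x y * (/ g x y * / g x y))).
  + intros x y; apply continuity_2d_pt_inv; [|apply Hn].
    eapply Ck_continuity; eassumption.
  + intros x y; assert (D := is_derive_dx k g x y Hg).
    evar_last; [apply (is_derive_inv _ _ _ D), Hn|field; apply Hn].
  + intros x y; assert (D := is_derive_dy k g x y Hg).
    evar_last; [apply (is_derive_inv _ _ _ D), Hn|field; apply Hn].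
  + repeat apply Ck_mult; try assumption; [apply Ck_const|apply Hg].
  + repeat apply Ck_mult; try assumption; [apply Ck_const|apply Hg].
Qed.

Lemma Ck_sqrt k g :
  (forall x y, 0 < g x y) -> Ck k g -> Ck k (fun x y => sqrt (g x y)).
Proof.
intros Hp.
assert (Hn : forall x y, sqrt (g x y) <> 0).
{ intros x y; apply Rgt_not_eq, sqrt_lt_R0, Hp. }
assert (H0 : (forall x y, continuity_2d_pt g x y) ->
             forall x y, continuity_2d_pt (fun x y => sqrt (g x y)) x y).
{ intros Hg x y; apply continuity_1d_2d_pt_comp; [|apply Hg].
  apply continuity_pt_sqrt, Rlt_le, Hp. }
induction k as [|k IH]; intros Hg; [exact (H0 Hg)|].
assert (Hi := Ck_inv _ _ Hn (IH (Ck_pred _ _ Hg))).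
apply (Ck_intro k _ (fun x y => / 2 * dx g x y * / sqrt (g x y))
                    (fun x y => / 2 * dy g x y * / sqrt (g x y))).
- apply H0, (Ck_continuity _ _ Hg).
- intros x y; assert (D := is_derive_dx k g x y Hg).
  evar_last; [apply (is_derive_sqrt _ _ _ D), Hp|simpl; field; apply Hn].
- intros x y; assert (D := is_derive_dy k g x y Hg).
  evar_last; [apply (is_derive_sqrt _ _ _ D), Hp|simpl; field; apply Hn].
- repeat apply Ck_mult; try assumption; [apply Ck_const|apply Hg].
- repeat apply Ck_mult; try assumption; [apply Ck_const|apply Hg].
Qed.

(** * Smooth functions: chain rule along lines, mixed derivatives, potentials *)

Lemma smooth2_dx g : smooth2 g -> smooth2 (dx g).
Proof. intros H k; apply (H (S k)). Qed.

Lemma smooth2_dy g : smooth2 g -> smooth2 (dy g).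
Proof. intros H k; apply (H (S k)). Qed.

Lemma smooth2_continuity g : smooth2 g -> forall x y, continuity_2d_pt g x y.
Proof. intros H; apply (Ck_continuity 0), H. Qed.

Lemma smooth2_is_dx g : smooth2 g ->
  forall x y, is_derive (fun t => g t y) x (dx g x y).
Proof. intros H x y; apply (is_derive_dx 0), H. Qed.

Lemma smooth2_is_dy g : smooth2 g ->
  forall x y, is_derive (fun t => g x t) y (dy g x y).
Proof. intros H x y; apply (is_derive_dy 0), H. Qed.

(** Both partial derivatives exist and [dx g] is continuous; this gives the total differential that
    the chain rule along lines needs. *)
Lemma smooth2_differentiable g : smooth2 g -> forall x y,
  differentiable_pt_lim g x y (dx g x y) (dy g x y).
Proof.
intros Hg x y; apply filterdiff_differentiable_pt_lim.
apply (is_derive_filterdiff g x y (dx g) (dy g x y)).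
- apply filter_forall; intros u; now apply smooth2_is_dx.
- now apply smooth2_is_dy.
- apply continuity_2d_pt_filterlim, smooth2_continuity, smooth2_dx, Hg.
Qed.

Lemma smooth2_schwarz g : smooth2 g -> forall x y,
  dx (dy g) x y = dy (dx g) x y.
Proof.
intros Hg x y; apply (Schwarz g x y).
- apply locally_2d_forall; intros u v.
  assert (Hx := smooth2_dx _ Hg); assert (Hy := smooth2_dy _ Hg).
  split; [|split; [|split]].
  + eexists; exact (smooth2_is_dx g Hg u v).
  + eexists; exact (smooth2_is_dy g Hg u v).
  + eexists; exact (smooth2_is_dx _ Hy u v).
  + eexists; exact (smooth2_is_dy _ Hx u v).
- apply (smooth2_continuity (dx (dy g))), smooth2_dx, smooth2_dy, Hg.
- apply (smooth2_continuity (dy (dx g))), smooth2_dy, smooth2_dx, Hg.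
Qed.

Lemma smooth2_line g : smooth2 g -> forall x y a b t,
  is_derive (fun t => g (x + t * a) (y + t * b)) t
    (a * dx g (x + t * a) (y + t * b) + b * dy g (x + t * a) (y + t * b)).
Proof.
intros Hg x y a b t; apply is_derive_Reals.
rewrite (Rmult_comm a), (Rmult_comm b).
apply (derivable_pt_lim_comp_2d g (fun t => x + t * a) (fun t => y + t * b)).
- now apply smooth2_differentiable.
- apply is_derive_Reals; auto_derive; [trivial|ring].
- apply is_derive_Reals; auto_derive; [trivial|ring].
Qed.

Lemma smooth2_const c : smooth2 (fun _ _ => c).
Proof. intros k; apply Ck_const. Qed.

Lemma smooth2_plus g h :
  smooth2 g -> smooth2 h -> smooth2 (fun x y => g x y + h x y).
Proof. intros Hg Hh k; now apply Ck_plus. Qed.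

Lemma smooth2_mult g h :
  smooth2 g -> smooth2 h -> smooth2 (fun x y => g x y * h x y).
Proof. intros Hg Hh k; now apply Ck_mult. Qed.

Lemma smooth2_minus g h :
  smooth2 g -> smooth2 h -> smooth2 (fun x y => g x y - h x y).
Proof.
intros Hg Hh.
replace (fun x y => g x y - h x y) with (fun x y => g x y + (- (1)) * h x y).
- apply smooth2_plus, (smooth2_mult (fun _ _ => - (1))); try assumption.
  apply smooth2_const.
- do 2 (apply functional_extensionality; intros ?); ring.
Qed.

Lemma smooth2_div g h :
  (forall x y, h x y <> 0) ->
  smooth2 g -> smooth2 h -> smooth2 (fun x y => g x y / h x y).
Proof.
intros Hn Hg Hh; apply (smooth2_mult g (fun x y => / h x y)); [exact Hg|].
intros k; now apply Ck_inv.
Qed.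

Lemma smooth2_sqrt g :
  (forall x y, 0 < g x y) -> smooth2 g -> smooth2 (fun x y => sqrt (g x y)).
Proof. intros Hp Hg k; now apply Ck_sqrt. Qed.

(* The line integral from the origin along the x-axis, then vertically. *)
Lemma smooth2_potential p q : smooth2 p -> smooth2 q ->
  (forall x y, dy p x y = dx q x y) ->
  exists F, smooth2 F /\ dx F = p /\ dy F = q.
Proof.
intros Hp Hq Hpq.
assert (Cp : forall x y, continuous (fun t => p t y) x).
{ intros x y; apply (ex_derive_continuous (fun t => p t y)).
  eexists; apply (smooth2_is_dx p Hp). }
assert (Cq : forall x y, continuous (fun t => q x t) y).
{ intros x y; apply (ex_derive_continuous (fun t => q x t)).
  eexists; apply (smooth2_is_dy q Hq). }
set (F := fun x y => RInt (fun t => p t 0) 0 x + RInt (fun t => q x t) 0 y).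
assert (Fx : forall x y, is_derive (fun t => F t y) x (p x y)).
{ intros x y; unfold F.
  (* The vertical integral contributes the integral of [q_x = p_y] from [0] to [y], that is
     [p x y - p x 0]. *)
  replace (p x y) with (p x 0 + (p x y - p x 0)) by ring.
  apply (is_derive_plus (fun x => RInt (fun t => p t 0) 0 x)
                        (fun x => RInt (fun t => q x t) 0 y)).
  - apply (is_derive_RInt (fun t => p t 0) (RInt (fun t => p t 0) 0) 0);
      [|apply Cp].
    apply filter_forall; intros z.
    apply (RInt_correct (fun t => p t 0) 0 z), (ex_RInt_continuous (fun t => p t 0)).
    intros; apply Cp.
  - evar_last; [apply (is_derive_RInt_param q 0 y x)|].
    + apply filter_forall; intros z t _; eexists; apply (smooth2_is_dx q Hq).
    + intros t _; apply (smooth2_continuity (dx q)), smooth2_dx, Hq.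
    + apply filter_forall; intros z.
      apply (ex_RInt_continuous (fun t => q z t)); intros; apply Cq.
    + rewrite (RInt_ext _ (Derive (fun t => p x t))).
      * apply RInt_Derive.
        -- intros z _; eexists; apply (smooth2_is_dy p Hp).
        -- intros z _; apply (ex_derive_continuous (fun t => dy p x t)).
           eexists; apply (smooth2_is_dy _ (smooth2_dy _ Hp)).
      * intros z _; symmetry; apply (Hpq x z). }
assert (Fy : forall x y, is_derive (fun t => F x t) y (q x y)).
{ intros x y; unfold F; replace (q x y) with (0 + q x y) by ring.
  apply (is_derive_plus (fun _ => RInt (fun t => p t 0) 0 x)
                        (fun y => RInt (fun t => q x t) 0 y)).
  - apply (is_derive_const (RInt (fun t => p t 0) 0 x)).
  - apply (is_derive_RInt (fun t => q x t) (RInt (fun t => q x t) 0) 0);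
      [|apply Cq].
    apply filter_forall; intros z.
    apply (RInt_correct (fun t => q x t) 0 z), (ex_RInt_continuous (fun t => q x t)).
    intros; apply Cq. }
exists F; split; [|split; [now apply dx_is_derive|now apply dy_is_derive]].
(* Partial derivatives alone would not make [F] continuous; continuity of [p] makes it
   differentiable. *)
assert (CF : forall x y, continuity_2d_pt F x y).
{ intros x y; apply differentiable_continuity_pt; exists (p x y), (q x y).
  apply filterdiff_differentiable_pt_lim.
  apply (is_derive_filterdiff F x y p (q x y)); [|apply Fy|].
  - apply filter_forall; intros u; apply Fx.
  - apply continuity_2d_pt_filterlim, smooth2_continuity, Hp. }
intros [|k]; [exact CF|now apply (Ck_intro k F p q)].
Qed.

(** * Differentiation rules as equations between functions *)

Lemma dx_const c : dx (fun _ _ => c) = fun _ _ => 0.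
Proof. apply dx_is_derive; intros x y; exact (is_derive_const c x). Qed.

Lemma dy_const c : dy (fun _ _ => c) = fun _ _ => 0.
Proof. apply dy_is_derive; intros x y; exact (is_derive_const c y). Qed.

Lemma smooth2_id1 : smooth2 (fun x _ : R => x).
Proof.
intros [|k]; [intros x y; apply continuity_2d_pt_id1|].
apply (Ck_intro k _ (fun _ _ => 1) (fun _ _ => 0)); try apply Ck_const;
  intros x y; [apply continuity_2d_pt_id1| |].
- exact (is_derive_id x).
- exact (is_derive_const x y).
Qed.

Lemma smooth2_id2 : smooth2 (fun _ y : R => y).
Proof.
intros [|k]; [intros x y; apply continuity_2d_pt_id2|].
apply (Ck_intro k _ (fun _ _ => 0) (fun _ _ => 1)); try apply Ck_const;
  intros x y; [apply continuity_2d_pt_id2| |].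
- exact (is_derive_const y x).
- exact (is_derive_id y).
Qed.

Lemma dx_id1 : dx (fun x _ => x) = fun _ _ => 1.
Proof.
apply (dx_is_derive (fun x _ : R => x));
intros x _; exact (is_derive_id x).
Qed.

Lemma dy_id1 : dy (fun x _ => x) = fun _ _ => 0.
Proof.
apply (dy_is_derive (fun x _ : R => x));
intros x y; exact (is_derive_const x y).
Qed.

Lemma dx_id2 : dx (fun _ y => y) = fun _ _ => 0.
Proof.
apply (dx_is_derive (fun _ y : R => y));
intros x y; exact (is_derive_const y x).
Qed.

Lemma dy_id2 : dy (fun _ y => y) = fun _ _ => 1.
Proof.
apply (dy_is_derive (fun _ y : R => y));
intros _ y; exact (is_derive_id y).
Qed.

Lemma dx_plus g h : smooth2 g -> smooth2 h ->
  dx (fun x y => g x y + h x y) = fun x y => dx g x y + dx h x y.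
Proof.
intros Hg Hh; apply dx_is_derive; intros x y.
exact (is_derive_plus _ _ x _ _ (smooth2_is_dx g Hg x y) (smooth2_is_dx h Hh x y)).
Qed.

Lemma dy_plus g h : smooth2 g -> smooth2 h ->
  dy (fun x y => g x y + h x y) = fun x y => dy g x y + dy h x y.
Proof.
intros Hg Hh; apply dy_is_derive; intros x y.
exact (is_derive_plus _ _ y _ _ (smooth2_is_dy g Hg x y) (smooth2_is_dy h Hh x y)).
Qed.

Lemma dx_mult g h : smooth2 g -> smooth2 h ->
  dx (fun x y => g x y * h x y)
  = fun x y => dx g x y * h x y + g x y * dx h x y.
Proof.
intros Hg Hh; apply dx_is_derive; intros x y.
exact (is_derive_mul (fun t => g t y) (fun t => h t y) x _ _
         (smooth2_is_dx g Hg x y) (smooth2_is_dx h Hh x y)).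
Qed.

Lemma dy_mult g h : smooth2 g -> smooth2 h ->
  dy (fun x y => g x y * h x y)
  = fun x y => dy g x y * h x y + g x y * dy h x y.
Proof.
intros Hg Hh; apply dy_is_derive; intros x y.
exact (is_derive_mul (fun t => g x t) (fun t => h x t) y _ _
         (smooth2_is_dy g Hg x y) (smooth2_is_dy h Hh x y)).
Qed.

Lemma dx_minus g h : smooth2 g -> smooth2 h ->
  dx (fun x y => g x y - h x y) = fun x y => dx g x y - dx h x y.
Proof.
intros Hg Hh; apply dx_is_derive; intros x y.
exact (is_derive_minus _ _ x _ _ (smooth2_is_dx g Hg x y) (smooth2_is_dx h Hh x y)).
Qed.

Lemma dy_minus g h : smooth2 g -> smooth2 h ->
  dy (fun x y => g x y - h x y) = fun x y => dy g x y - dy h x y.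
Proof.
intros Hg Hh; apply dy_is_derive; intros x y.
exact (is_derive_minus _ _ y _ _ (smooth2_is_dy g Hg x y) (smooth2_is_dy h Hh x y)).
Qed.

(** * Maximum principle *)

(** If [l > 0], then [f1 t - f1 0] has the sign of [t] near 0. By the mean value theorem [f] then
    exceeds [f 0] just to the right of 0 when [f1 0 >= 0], and just to the left when [f1 0 < 0]. *)
Lemma second_derivative_at_max (f f1 : R -> R) l :
  locally 0 (fun t => is_derive f t (f1 t)) ->
  is_derive f1 0 l ->
  locally 0 (fun t => f t <= f 0) -> l <= 0.
Proof.
intros [d1 H1] H2 [d2 Hm].
destruct (Rle_or_lt l 0) as [H|Hl]; [exact H|exfalso].
apply is_derive_Reals in H2.
destruct (H2 (l / 2)) as [d3 H3]; [lra|].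
set (h := Rmin d1 (Rmin d2 d3) / 2).
assert (Hh : 0 < h /\ h < d1 /\ h < d2 /\ h < d3).
{ assert (0 < Rmin d1 (Rmin d2 d3)).
  { repeat apply Rmin_pos; apply cond_pos. }
  generalize (Rmin_l d1 (Rmin d2 d3)) (Rmin_r d1 (Rmin d2 d3))
    (Rmin_l d2 d3) (Rmin_r d2 d3); intros; unfold h; lra. }
assert (Hd : forall c, Rabs c <= h -> derivable_pt_lim f c (f1 c)).
{ intros c Hc; apply is_derive_Reals, H1.
  unfold ball; simpl; unfold AbsRing_ball, abs, minus, plus, opp; simpl.
  rewrite Ropp_0, Rplus_0_r; lra. }
assert (Hf : forall c, Rabs c <= h -> f c <= f 0).
{ intros c Hc; apply Hm.
  unfold ball; simpl; unfold AbsRing_ball, abs, minus, plus, opp; simpl.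
  rewrite Ropp_0, Rplus_0_r; lra. }
assert (Hs : forall c, c <> 0 -> Rabs c < h -> 0 < (f1 c - f1 0) / c).
{ intros c Hc Hc'; assert (B := H3 c Hc ltac:(lra)).
  rewrite Rplus_0_l in B; apply Rabs_def2 in B; lra. }
destruct (Rle_or_lt 0 (f1 0)) as [Hp|Hn].
- destruct (MVT_cor2 f f1 0 h) as [c [Ec Hc]]; [lra| |].
  + intros c Hc; apply Hd; rewrite Rabs_pos_eq; lra.
  + assert (B := Hs c ltac:(lra) ltac:(rewrite Rabs_pos_eq; lra)).
    assert (B' := Hf h ltac:(rewrite Rabs_pos_eq; lra)).
    assert (0 < f1 c - f1 0).
    { replace (f1 c - f1 0) with ((f1 c - f1 0) / c * c) by (field; lra).
      apply Rmult_lt_0_compat; lra. }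
    nra.
- destruct (MVT_cor2 f f1 (- h) 0) as [c [Ec Hc]]; [lra| |].
  + intros c Hc; apply Hd; rewrite Rabs_left1; lra.
  + assert (B := Hs c ltac:(lra) ltac:(rewrite Rabs_left1; lra)).
    assert (B' := Hf (- h) ltac:(rewrite Rabs_left1; lra)).
    assert (0 < f1 0 - f1 c).
    { replace (f1 0 - f1 c) with ((f1 c - f1 0) / c * (- c)) by (field; lra).
      apply Rmult_lt_0_compat; lra. }
    nra.
Qed.

(** Maximise first in [y], then in [x]. The chosen maximiser [m x] may jump, but the value
    [g x (m x)] is continuous in [x] by uniform continuity of [g]. *)
Lemma rectangle_max (g : R -> R -> R) a b c d : a <= b -> c <= d ->
  (forall x y, continuity_2d_pt g x y) ->
  exists x0 y0, a <= x0 <= b /\ c <= y0 <= d /\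
    forall x y, a <= x <= b -> c <= y <= d -> g x y <= g x0 y0.
Proof.
intros Hab Hcd Hg.
assert (Hy : forall x, exists y,
          c <= y <= d /\ forall z, c <= z <= d -> g x z <= g x y).
{ intros x; destruct (continuity_ab_maj (g x) c d Hcd) as [y [H1 H2]].
  - intros y _ eps Heps; destruct (Hg x y (mkposreal eps Heps)) as [del Hdel].
    exists del; split; [apply cond_pos|].
    intros z [_ Hz]; apply Hdel; [|exact Hz].
    rewrite Rminus_diag, Rabs_R0; apply cond_pos.
  - now exists y. }
set (m := fun x => proj1_sig (constructive_indefinite_description _ (Hy x))).
assert (Hm : forall x, c <= m x <= d /\
               forall z, c <= z <= d -> g x z <= g x (m x)).
{ intros x; unfold m; now destruct constructive_indefinite_description. }
destruct (continuity_ab_maj (fun x => g x (m x)) a b Hab) as [x0 [H1 H2]].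
- intros x Hx eps Heps.
  (* The interval is widened by 1 because continuity at the endpoints [a] and [b] is two-sided. *)
  destruct (uniform_continuity_2d g (a - 1) (b + 1) c d
              (fun x y _ _ => Hg x y) (mkposreal eps Heps)) as [del Hdel].
  exists (Rmin del 1); split.
  { apply Rmin_pos; [apply cond_pos|lra]. }
  intros z [_ Hz]; simpl in Hz; unfold Rdist in Hz.
  assert (Hz1 := Rlt_le_trans _ _ _ Hz (Rmin_l _ _)).
  assert (Hz2 := Rlt_le_trans _ _ _ Hz (Rmin_r _ _)).
  apply Rabs_def2 in Hz2.
  assert (B : forall y, c <= y <= d -> Rabs (g z y - g x y) < eps).
  { intros y Hcy; apply (Hdel x y z y); try lra.
    rewrite Rminus_diag, Rabs_R0; apply cond_pos. }
  simpl; unfold Rdist.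
  destruct (Hm x) as [Hmx Hmx']; destruct (Hm z) as [Hmz Hmz'].
  assert (B1 := Rabs_def2 _ _ (B _ Hmx)).
  assert (B2 := Rabs_def2 _ _ (B _ Hmz)).
  specialize (Hmx' _ Hmz); specialize (Hmz' _ Hmx).
  apply Rabs_def1; lra.
- exists x0, (m x0); split; [exact H2|split; [apply Hm|]].
  intros x y Hx Hy'; eapply Rle_trans; [apply Hm, Hy'|apply (H1 x Hx)].
Qed.

(* [t psi'(t) = 1 + 1 / (1 + t)] is decreasing, so [psi (x^2 + y^2)] is strictly
   superharmonic in the plane minus the origin, and it tends to infinity. *)
Definition psi (t : R) := ln (t * t / (1 + t)).

Lemma psi_arg_pos t : 0 < t -> 0 < t * t / (1 + t).
Proof. intros Ht; apply Rdiv_lt_0_compat; nra. Qed.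

Lemma psi_le s t : 0 < s -> s <= t -> psi s <= psi t.
Proof.
intros Hs Hst; unfold psi; apply ln_le; [now apply psi_arg_pos|].
apply Rle_div_l; [lra|].
replace (t * t / (1 + t) * (1 + s)) with (t * t * (1 + s) / (1 + t)) by (field; lra).
apply (proj1 (Rle_div_r (s * s) _ (1 + t) ltac:(lra))).
(* This product is [t^2 (1 + s) - s^2 (1 + t)]. *)
assert (0 <= (t - s) * (s + t + s * t)); [|nra].
apply Rmult_le_pos; nra.
Qed.

(** For [t >= 2] the argument [t^4 / (1 + t^2)] of the logarithm is at least [t]. The explicit
    threshold later fixes the size of a rectangle. *)
Lemma psi_ge t K : 2 <= t -> exp K <= t -> K <= psi (t * t).
Proof.
intros Ht HK; unfold psi; rewrite <- (ln_exp K); apply ln_le; [apply exp_pos|].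
apply Rle_trans with t; [exact HK|].
apply (proj1 (Rle_div_r t _ (1 + t * t) ltac:(nra))).
assert (0 <= t * (t * t * t - 1 - t * t)); [|nra].
apply Rmult_le_pos; nra.
Qed.

Lemma is_derive_psi t : 0 < t -> is_derive psi t (2 / t - / (1 + t)).
Proof.
intros Ht; unfold psi; auto_derive.
- split; [lra|split; [now apply psi_arg_pos|trivial]].
- field; lra.
Qed.

(** The second derivative test for [U - eps * psi S] with [S = A^2 + B^2]: the bracket is
    [psi'(S) S'' + psi''(S) S'^2] at 0. [A] and [B] will be the coordinates of Lewy's map along a
    line, relative to a centre. *)
Lemma comparison_second_derivative (U U1 A A1 B B1 : R -> R) (U2 A2 B2 eps : R) :
  (forall t, is_derive U t (U1 t)) -> is_derive U1 0 U2 ->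
  (forall t, is_derive A t (A1 t)) -> is_derive A1 0 A2 ->
  (forall t, is_derive B t (B1 t)) -> is_derive B1 0 B2 ->
  let T := A 0 * A 0 + B 0 * B 0 in
  0 < T ->
  locally 0 (fun t => U t - eps * psi (A t * A t + B t * B t)
                      <= U 0 - eps * psi T) ->
  U2 - eps * ((2 / T - / (1 + T)) *
                (2 * (A1 0 * A1 0 + B1 0 * B1 0 + A 0 * A2 + B 0 * B2)) +
              (/ (1 + T) ^ 2 - 2 / T ^ 2) *
                (2 * (A 0 * A1 0 + B 0 * B1 0)) ^ 2) <= 0.
Proof.
intros DU DU1 DA DA1 DB DB1 T HT Hm.
set (S := fun t => A t * A t + B t * B t).
set (S1 := fun t => 2 * (A t * A1 t + B t * B1 t)).
assert (DS : forall t, is_derive S t (S1 t)).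
{ intros t; unfold S, S1.
  evar_last; [exact (is_derive_plus _ _ t _ _
    (is_derive_mul A A t _ _ (DA t) (DA t))
    (is_derive_mul B B t _ _ (DB t) (DB t)))|].
  unfold plus; simpl; ring. }
assert (DS1 : is_derive S1 0
          (2 * (A1 0 * A1 0 + B1 0 * B1 0 + A 0 * A2 + B 0 * B2))).
{ unfold S1; evar_last.
  - exact (is_derive_scal _ 0 2 _ (is_derive_plus _ _ 0 _ _
      (is_derive_mul A A1 0 _ _ (DA 0) DA1)
      (is_derive_mul B B1 0 _ _ (DB 0) DB1))).
  - unfold plus; simpl; ring. }
(* [psi] is differentiated only at positive arguments, so [S] must stay positive near 0. *)
assert (PS : locally 0 (fun t => 0 < S t)).
{ assert (C : continuous S 0) 
  by (apply (ex_derive_continuous S); eexists; apply DS).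
  apply (C (fun z => 0 < z)), (open_gt 0), HT. }
set (V1 := fun t => U1 t - eps * ((2 / S t - / (1 + S t)) * S1 t)).
apply (second_derivative_at_max (fun t => U t - eps * psi (S t)) V1).
- revert PS; apply filter_imp; intros t Ht; unfold V1.
  apply (is_derive_minus U (fun t => eps * psi (S t))); [apply DU|].
  apply is_derive_scal.
  evar_last; [apply (is_derive_comp psi S); [now apply is_derive_psi|apply DS]|].
  unfold scal; simpl; unfold mult; simpl; ring.
- unfold V1.
  apply (is_derive_minus U1 (fun t => eps * ((2 / S t - / (1 + S t)) * S1 t)));
    [apply DU1|].
  apply is_derive_scal.
  assert (D0 := DS 0).
  evar_last.
  + apply (is_derive_mul (fun t => 2 / S t - / (1 + S t)) S1); [|exact DS1].
    apply (is_derive_comp (fun s => 2 / s - / (1 + s)) S 0); [|exact D0].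
    auto_derive; [|reflexivity].
    change (S 0) with T; lra.
  + change (S 0) with T; unfold scal; simpl; unfold mult; simpl.
    change (S1 0) with (2 * (A 0 * A1 0 + B 0 * B1 0)); field; lra.
- exact Hm.
Qed.

(** * Liouville's theorem for the conformal structure of a unimodular Hessian *)

Lemma smooth2_line_second g : smooth2 g -> forall x y a b,
  is_derive (fun t => a * dx g (x + t * a) (y + t * b)
                      + b * dy g (x + t * a) (y + t * b)) 0
    (a * a * dx (dx g) x y + 2 * a * b * dy (dx g) x y + b * b * dy (dy g) x y).
Proof.
intros Hg x y a b.
assert (Hx := smooth2_line _ (smooth2_dx _ Hg) x y a b 0).
assert (Hy := smooth2_line _ (smooth2_dy _ Hg) x y a b 0).
rewrite !Rmult_0_l, !Rplus_0_r in Hx, Hy.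
evar_last; [exact (is_derive_plus _ _ 0 _ _
  (is_derive_scal _ 0 a _ Hx) (is_derive_scal _ 0 b _ Hy))|].
unfold plus; simpl; rewrite (smooth2_schwarz g Hg x y); ring.
Qed.

Lemma comparison_direction (u xi eta : R -> R -> R) x y c d a b eps :
  smooth2 u -> smooth2 xi -> smooth2 eta ->
  let X := xi x y - c in
  let Y := eta x y - d in
  let T := X * X + Y * Y in
  let D g := a * dx g x y + b * dy g x y in
  let D2 g := a * a * dx (dx g) x y + 2 * a * b * dy (dx g) x y
              + b * b * dy (dy g) x y in
  0 < T ->
  locally_2d (fun v w =>
    u v w - eps * psi ((xi v w - c) * (xi v w - c)
                       + (eta v w - d) * (eta v w - d))
    <= u x y - eps * psi T) x y ->
  D2 u - eps * ((2 / T - / (1 + T)) *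
                  (2 * (D xi * D xi + D eta * D eta
                        + X * D2 xi + Y * D2 eta)) +
                (/ (1 + T) ^ 2 - 2 / T ^ 2) *
                  (2 * (X * D xi + Y * D eta)) ^ 2) <= 0.
Proof.
intros Hu Hxi Heta X Y T D D2 HT [del Hm].
set (L := fun (g : R -> R -> R) t => g (x + t * a) (y + t * b)).
assert (L0 : forall g, L g 0 = g x y).
{ intros g; unfold L; now rewrite !Rmult_0_l, !Rplus_0_r. }
assert (DL : forall g e, smooth2 g -> forall t,
  is_derive (fun t => L g t - e) t (a * L (dx g) t + b * L (dy g) t)).
{ intros g e Hg t; evar_last;
    [exact (is_derive_minus _ _ t _ _ (smooth2_line g Hg x y a b t)
              (is_derive_const e t))|].
  unfold minus, plus, opp, zero; simpl; unfold L; ring. }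
assert (DU : forall t, is_derive (L u) t (a * L (dx u) t + b * L (dy u) t)).
{ intros t; exact (smooth2_line u Hu x y a b t). }
assert (M := comparison_second_derivative (L u) _ (fun t => L xi t - c) _
  (fun t => L eta t - d) _ _ _ _ eps
  DU (smooth2_line_second u Hu x y a b)
  (DL xi c Hxi) (smooth2_line_second xi Hxi x y a b)
  (DL eta d Heta) (smooth2_line_second eta Heta x y a b)).
cbv beta zeta in M; rewrite !L0 in M; apply M; [exact HT|clear M].
(* [k] dominates [|a|] and [|b|], so [|t| < del / k] keeps the line inside the square of half-width
   [del]; the summand 1 makes [k] positive. *)
set (k := 1 + Rabs a + Rabs b).
assert (Hk : 0 < k) by (unfold k; generalize (Rabs_pos a) (Rabs_pos b); lra).
exists (mkposreal (del / k) (Rdiv_lt_0_compat _ _ (cond_pos del) Hk)).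
intros t Ht.
unfold ball in Ht; simpl in Ht.
unfold AbsRing_ball, abs, minus, plus, opp in Ht; simpl in Ht.
rewrite Ropp_0, Rplus_0_r in Ht.
assert (Ht' : Rabs t * k < del) by now apply Rlt_div_r.
assert (B := Rabs_pos t); assert (Ba := Rabs_pos a); assert (Bb := Rabs_pos b).
apply Hm.
- replace (x + t * a - x) with (t * a) by ring; rewrite Rabs_mult.
  apply Rle_lt_trans with (2 := Ht'); apply Rmult_le_compat_l; unfold k; lra.
- replace (y + t * b - y) with (t * b) by ring; rewrite Rabs_mult.
  apply Rle_lt_trans with (2 := Ht'); apply Rmult_le_compat_l; unfold k; lra.
Qed.

(* The directions (1,0) and (s,-r) diagonalise [L = t dxx - 2 s dxy + r dyy]:
   the corresponding second derivatives add up to [r L], and the coordinates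
   [x + F], [y + G] have orthogonal gradients of equal length for them. *)
Lemma no_interior_max (F G u : R -> R -> R) c d x y eps :
  smooth2 F -> smooth2 G -> smooth2 u ->
  (forall x y, dy F x y = dx G x y) ->
  (forall x y, 0 < dx F x y) ->
  (forall x y, dx F x y * dy G x y - dy F x y * dy F x y = 1) ->
  dy G x y * dx (dx u) x y - 2 * dy F x y * dy (dx u) x y
    + dx F x y * dy (dy u) x y = 0 ->
  let T v w := (v + F v w - c) * (v + F v w - c)
               + (w + G v w - d) * (w + G v w - d) in
  0 < eps -> 0 < T x y ->
  ~ locally_2d (fun v w => u v w - eps * psi (T v w)
                           <= u x y - eps * psi (T x y)) x y.
Proof.
intros HF HG Hu HFG Hr Hdet HL T Heps HT Hm.
set (xi := fun v w => v + F v w); set (eta := fun v w => w + G v w).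
assert (HF1 := smooth2_dx _ HF); assert (HF2 := smooth2_dy _ HF).
assert (HG1 := smooth2_dx _ HG); assert (HG2 := smooth2_dy _ HG).
assert (I1 := smooth2_id1); assert (I2 := smooth2_id2).
assert (Hxi : smooth2 xi) by exact (smooth2_plus _ _ I1 HF).
assert (Heta : smooth2 eta) by exact (smooth2_plus _ _ I2 HG).
assert (EFG : dx G = dy F).
{ do 2 (apply functional_extensionality; intros ?); now rewrite HFG. }
assert (X1 : dx xi = fun v w => 1 + dx F v w).
{ unfold xi; now rewrite dx_plus, dx_id1. }
assert (X2 : dy xi = fun v w => 0 + dy F v w).
{ unfold xi; now rewrite dy_plus, dy_id1. }
assert (E1 : dx eta = fun v w => 0 + dy F v w).
{ unfold eta; now rewrite dx_plus, dx_id2, EFG. }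
assert (E2 : dy eta = fun v w => 1 + dy G v w).
{ unfold eta; now rewrite dy_plus, dy_id2. }
assert (C := smooth2_const).
assert (Edet : (fun x y => dx F x y * dy G x y - dy F x y * dy F x y)
               = fun _ _ => 1).
{ do 2 (apply functional_extensionality; intros ?); apply Hdet. }
(* Differentiating [r t - s^2 = 1] in [x] gives [t r_x - 2 s r_y + r s_y = 0], so [L] annihilates
   [xi]; the [y]-derivative does the same for [eta]. *)
assert (Ex := f_equal (fun g => dx g x y) Edet).
assert (Ey := f_equal (fun g => dy g x y) Edet).
cbv beta in Ex, Ey.
rewrite dx_const, dx_minus, !dx_mult in Ex by (assumption || now apply smooth2_mult).
rewrite dy_const, dy_minus, !dy_mult in Ey by (assumption || now apply smooth2_mult).
rewrite (smooth2_schwarz G HG), EFG, (smooth2_schwarz F HF) in Ex.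
assert (M : forall a b, _) by exact (fun a b =>
  comparison_direction u xi eta x y c d a b eps Hu Hxi Heta HT Hm).
assert (M1 := M 1 0); assert (M2 := M (dy F x y) (- dx F x y)); clear M.
cbv zeta beta in M1, M2.
rewrite X1, X2, E1, E2, !dx_plus, !dy_plus, !dx_const, !dy_const in M1, M2
  by (assumption || apply C).
rewrite (smooth2_schwarz F HF) in M1, M2.
change (xi x y) with (x + F x y) in M1, M2.
change (eta x y) with (y + G x y) in M1, M2.
specialize (Hdet x y); specialize (Hr x y).
unfold T in HT.
set (X := x + F x y - c) in *; set (Y := y + G x y - d) in *.
generalize dependent (dx F x y); intros r; intros.
generalize dependent (dy F x y); intros s; intros.
generalize dependent (dy G x y); intros t; intros.
(* For a function annihilated by [L], the second derivative along [(s, -r)] is minus the one along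
   [(1, 0)]. All second derivatives of [u], [xi] and [eta] thus cancel when [M1] and [M2] are
   added. *)
assert (L2 : forall A B C, t * A - 2 * s * B + r * C = 0 ->
               s * s * A + 2 * s * - r * B + - r * - r * C = - A).
{ intros A B C' H.
  replace (s * s * A + 2 * s * - r * B + - r * - r * C')
    with (r * (t * A - 2 * s * B + r * C') - A * (r * t - s * s)) by ring.
  rewrite H, Hdet; ring. }
rewrite !Rplus_0_l in M1, M2.
rewrite 3!L2 in M2 by (lra || exact HL).
replace (s * s + - r * (1 + t)) with (- (1 + r)) in M2 by lra.
set (S := X * X + Y * Y) in *.
(* Strict superharmonicity: [psi'(S) + S psi''(S) = - 1 / (1 + S)^2]. *)
assert (HPQ : (2 / S - / (1 + S)) + (/ (1 + S) ^ 2 - 2 / S ^ 2) * S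
              = - / (1 + S) ^ 2) by (field; lra).
assert (HS : 0 < / (1 + S) ^ 2) by (apply Rinv_0_lt_compat, pow_lt; lra).
set (P := 2 / S - / (1 + S)) in *.
set (Q := / (1 + S) ^ 2 - 2 / S ^ 2) in *.
(* The derivatives of [(xi, eta)] are [(1 + r, s)] along the first direction and [(s, -(1 + r))]
   along the second: orthogonal, with the same squared length [K]. Hence the squares of their
   products with [(X, Y)] add up to [K S]. *)
set (K := (1 + r) * (1 + r) + s * s).
assert (HK : 0 < K) by (unfold K; nra).
assert (Hsum : - 4 * eps * K * (P + Q * S) <= 0) by (unfold S, K; lra).
rewrite HPQ in Hsum.
assert (0 < eps * K * / (1 + S) ^ 2); [|lra].
repeat apply Rmult_lt_0_compat; assumption.
Qed.

(** [(F, G)] has the positive definite symmetric Jacobian matrix with rows [(r, s)] and [(s, t)], so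
    it is monotone: its increment has nonnegative inner product with [(x - a, y - b)]. Adding a
    monotone map to the identity cannot shrink distances. *)
Lemma shear_expands (F G : R -> R -> R) :
  smooth2 F -> smooth2 G ->
  (forall x y, dy F x y = dx G x y) ->
  (forall x y, 0 < dx F x y) ->
  (forall x y, dx F x y * dy G x y - dy F x y * dy F x y = 1) ->
  forall a b x y,
  (x - a) * (x - a) + (y - b) * (y - b) <=
  (x + F x y - (a + F a b)) * (x + F x y - (a + F a b)) +
  (y + G x y - (b + G a b)) * (y + G x y - (b + G a b)).
Proof.
intros HF HG HFG Hr Hdet a b x y.
set (p := x - a); set (q := y - b).
destruct (MVT_gen (fun t => p * F (a + t * p) (b + t * q)
                            + q * G (a + t * p) (b + t * q)) 0 1
  (fun t => p * (p * dx F (a + t * p) (b + t * q)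
                 + q * dy F (a + t * p) (b + t * q))
          + q * (p * dx G (a + t * p) (b + t * q)
                 + q * dy G (a + t * p) (b + t * q))))
  as [c [_ Hc]].
- intros t _; exact (is_derive_plus _ _ t _ _
    (is_derive_scal _ t p _ (smooth2_line F HF a b p q t))
    (is_derive_scal _ t q _ (smooth2_line G HG a b p q t))).
- intros t _; apply derivable_continuous_pt, ex_derive_Reals_0.
  eexists; exact (is_derive_plus _ _ t _ _
    (is_derive_scal _ t p _ (smooth2_line F HF a b p q t))
    (is_derive_scal _ t q _ (smooth2_line G HG a b p q t))).
- rewrite !Rmult_0_l, !Rplus_0_r, !Rmult_1_l, <- HFG in Hc.
  replace (a + p) with x in Hc by (unfold p; ring).
  replace (b + q) with y in Hc by (unfold q; ring).
  specialize (Hr (a + c * p) (b + c * q)).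
  specialize (Hdet (a + c * p) (b + c * q)).
  revert Hc Hr Hdet.
  generalize (dx F (a + c * p) (b + c * q)) (dy F (a + c * p) (b + c * q))
    (dy G (a + c * p) (b + c * q)); intros r s t Hc Hr Hdet.
  assert (0 <= p * (p * r + q * s) + q * (p * s + q * t)).
  { apply (Rmult_le_reg_l r); [exact Hr|].
    replace (r * (p * (p * r + q * s) + q * (p * s + q * t)))
      with ((p * r + q * s) ^ 2 + q ^ 2 * (r * t - s * s)) by ring.
    rewrite Hdet; generalize (pow2_ge_0 (p * r + q * s)) (pow2_ge_0 q); lra. }
  generalize (pow2_ge_0 (F x y - F a b)) (pow2_ge_0 (G x y - G a b)).
  unfold p, q in *; nra.
Qed.

(** Truncation at [t0] removes the singularity of [psi] at 0, so the comparison function is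
    continuous on whole rectangles. *)
Lemma continuity_pt_psi_max t0 : 0 < t0 ->
  forall t, continuity_pt (fun t => psi (Rmax t0 t)) t.
Proof.
intros Ht0 t; apply (continuity_pt_comp (Rmax t0) psi).
- intros e He; exists e; split; [exact He|].
  intros z [_ Hz]; simpl in *; unfold Rdist in *.
  apply Rle_lt_trans with (2 := Hz).
  unfold Rmax, Rabs; repeat destruct Rle_dec; repeat destruct Rcase_abs; lra.
- apply derivable_continuous_pt, ex_derive_Reals_0; eexists.
  apply is_derive_psi; generalize (Rmax_l t0 t); lra.
Qed.

(** On a large rectangle the maximum of [u - eps * psi T], truncated near [(a, b)], can lie only
    where [T <= t0], and there [u] is close to [u a b]. Then [eps] is made small. *)
Lemma Liouville_one_sided (F G u : R -> R -> R) M :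
  smooth2 F -> smooth2 G -> smooth2 u ->
  (forall x y, dy F x y = dx G x y) ->
  (forall x y, 0 < dx F x y) ->
  (forall x y, dx F x y * dy G x y - dy F x y * dy F x y = 1) ->
  (forall x y, dy G x y * dx (dx u) x y - 2 * dy F x y * dy (dx u) x y
               + dx F x y * dy (dy u) x y = 0) ->
  (forall x y, Rabs (u x y) <= M) ->
  forall a b x y, u x y <= u a b.
Proof.
intros HF HG Hu HFG Hr Hdet HL HM a b x1 y1.
set (T := fun v w =>
  (v + F v w - (a + F a b)) * (v + F v w - (a + F a b))
  + (w + G v w - (b + G a b)) * (w + G v w - (b + G a b))).
assert (HT := shear_expands F G HF HG HFG Hr Hdet a b : forall x y, _ <= T x y).
assert (CT : forall x y, continuity_2d_pt T x y).
{ apply smooth2_continuity; unfold T.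
  apply smooth2_plus; apply smooth2_mult; apply smooth2_minus;
    try apply smooth2_const; apply smooth2_plus; try assumption;
    apply smooth2_id1 || apply smooth2_id2. }
apply le_epsilon; intros e He.
destruct (smooth2_continuity u Hu a b (mkposreal (e / 2) ltac:(lra)))
  as [del Hdel]; simpl in Hdel.
assert (Hd := cond_pos del).
(* Since [T] dominates the squared distance to [(a, b)], [T <= t0] forces both coordinates to within
   [del]. *)
set (t0 := del / 2 * (del / 2)); assert (Ht0 : 0 < t0) by (unfold t0; nra).
assert (Hsq : forall z r, 0 < r -> z * z < r * r -> - r < z < r).
{ intros z r Hr0 Hz; split; nra. }
assert (Hnear : forall x y, T x y <= t0 -> u x y <= u a b + e / 2).
{ intros x y Hxy; specialize (HT x y); unfold t0 in Hxy.
  assert (Px := Rle_0_sqr (x - a)); assert (Py := Rle_0_sqr (y - b)).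
  unfold Rsqr in Px, Py.
  destruct (Hsq (x - a) del Hd) as [X1 X2]; [nra|].
  destruct (Hsq (y - b) del Hd) as [Y1 Y2]; [nra|].
  assert (B := Rabs_def2 _ _ (Hdel x y
    ltac:(apply Rabs_def1; lra) ltac:(apply Rabs_def1; lra))); lra. }
assert (HTab : T a b = 0) by (unfold T; ring).
assert (key : forall eps, 0 < eps ->
  u x1 y1 - eps * psi (Rmax t0 (T x1 y1)) <= u a b + e / 2 - eps * psi t0).
{ intros eps Heps.
  set (w := fun x y => u x y - eps * psi (Rmax t0 (T x y))).
  (* Where [psi T >= k], the penalty pushes [w] below [w a b], as [u] varies by at most [2 M]. The
     radius [r] ensures this for [T >= r^2] and puts [(x1, y1)] in the rectangle. *)
  set (k := 2 * M / eps + psi t0 + 1).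
  set (r := 2 + exp k + Rabs (x1 - a) + Rabs (y1 - b)).
  assert (B1 := exp_pos k).
  assert (B2 := Rabs_pos (x1 - a)); assert (B3 := Rabs_pos (y1 - b)).
  assert (B4 := Rabs_maj2 (x1 - a)); assert (B5 := Rabs_maj2 (y1 - b)).
  assert (B6 := Rle_abs (x1 - a)); assert (B7 := Rle_abs (y1 - b)).
  destruct (rectangle_max w (a - r) (a + r) (b - r) (b + r))
    as [x0 [y0 [Hx0 [Hy0 Hmax]]]]; try (unfold r; lra).
  { intros x y; apply continuity_2d_pt_minus; [now apply smooth2_continuity|].
    apply continuity_2d_pt_mult; [apply continuity_2d_pt_const|].
    apply (continuity_1d_2d_pt_comp (fun t => psi (Rmax t0 t)));
      [now apply continuity_pt_psi_max|apply CT]. }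
  apply Rle_trans with (w x0 y0); [apply Hmax; unfold r; lra|].
  destruct (Rle_or_lt (T x0 y0) t0) as [Hle|Hgt].
  { unfold w; rewrite Rmax_left by exact Hle; generalize (Hnear _ _ Hle); lra. }
  exfalso.
  assert (Hw : w x0 y0 = u x0 y0 - eps * psi (T x0 y0)).
  { unfold w; rewrite Rmax_right by lra; reflexivity. }
  assert (Hc := Hmax a b ltac:(unfold r; lra) ltac:(unfold r; lra)).
  assert (Hwab : w a b = u a b - eps * psi t0).
  { unfold w; rewrite HTab, Rmax_left by lra; reflexivity. }
  (* This puts the maximum point strictly inside the rectangle, again because [T] dominates the
     squared distance. *)
  assert (Hfar : T x0 y0 < r * r).
  { apply Rnot_le_lt; intros Hfar.
    assert (P1 : k <= psi (T x0 y0)).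
    { apply Rle_trans with (psi (r * r)).
      - apply psi_ge; unfold r; lra.
      - apply psi_le; [|exact Hfar]. apply Rmult_lt_0_compat; unfold r; lra. }
    assert (P2 : eps * k = 2 * M + eps * psi t0 + eps) by (unfold k; field; lra).
    assert (P3 := Rmult_le_compat_l eps _ _ (Rlt_le _ _ Heps) P1).
    assert (P4 := HM a b); assert (P5 := HM x0 y0).
    apply Rabs_le_between in P4; apply Rabs_le_between in P5; lra. }
  assert (Hr0 : 0 < r) by (unfold r; lra).
  specialize (HT x0 y0).
  assert (Px := Rle_0_sqr (x0 - a)); assert (Py := Rle_0_sqr (y0 - b)).
  unfold Rsqr in Px, Py.
  assert (Hx0' := Hsq (x0 - a) r Hr0 ltac:(lra)).
  assert (Hy0' := Hsq (y0 - b) r Hr0 ltac:(lra)).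
  apply (no_interior_max F G u (a + F a b) (b + G a b) x0 y0 eps); try easy.
  { change (0 < T x0 y0); lra. }
  destruct (CT x0 y0 (mkposreal (T x0 y0 - t0) ltac:(lra))) as [d1 Hd1].
  simpl in Hd1.
  (* Within [d] of the maximum point one stays in the rectangle and keeps [T > t0], where the
     truncation is inactive. *)
  set (d := Rmin d1 (Rmin (Rmin (x0 - (a - r)) (a + r - x0))
                          (Rmin (y0 - (b - r)) (b + r - y0)))).
  assert (Hd0 : 0 < d).
  { repeat apply Rmin_pos; try lra; apply cond_pos. }
  exists (mkposreal d Hd0); simpl; intros x y Hx Hy.
  change (u x y - eps * psi (T x y) <= u x0 y0 - eps * psi (T x0 y0)).
  assert (D1 : d <= d1) by apply Rmin_l.
  assert (D2 : d <= Rmin (Rmin (x0 - (a - r)) (a + r - x0))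
                          (Rmin (y0 - (b - r)) (b + r - y0))) by apply Rmin_r.
  assert (D3 := Rle_trans _ _ _ D2 (Rmin_l _ _)).
  assert (D4 := Rle_trans _ _ _ D2 (Rmin_r _ _)).
  assert (D5 := Rle_trans _ _ _ D3 (Rmin_l _ _)).
  assert (D6 := Rle_trans _ _ _ D3 (Rmin_r _ _)).
  assert (D7 := Rle_trans _ _ _ D4 (Rmin_l _ _)).
  assert (D8 := Rle_trans _ _ _ D4 (Rmin_r _ _)).
  assert (B := Rabs_def2 _ _ (Hd1 x y ltac:(lra) ltac:(lra))).
  apply Rabs_def2 in Hx; apply Rabs_def2 in Hy.
  assert (Hxy := Hmax x y ltac:(lra) ltac:(lra)).
  rewrite Hw in Hxy; unfold w in Hxy; rewrite Rmax_right in Hxy by lra.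
  exact Hxy. }
set (z := psi (Rmax t0 (T x1 y1)) - psi t0).
assert (Hz := Rabs_pos z).
(* This [eps] makes [eps * z] at most [e / 2], the remaining half of the error. *)
assert (Hk := key (e / 2 / (1 + Rabs z)) ltac:(apply Rdiv_lt_0_compat; lra)).
set (eps := e / 2 / (1 + Rabs z)) in *.
assert (E : eps * (1 + Rabs z) = e / 2) by (unfold eps; field; lra).
assert (0 < eps) by (unfold eps; apply Rdiv_lt_0_compat; lra).
assert (eps * z <= eps * Rabs z).
{ apply Rmult_le_compat_l; [lra|apply Rle_abs]. }
unfold z in *; lra.
Qed.

Lemma Liouville (F G u : R -> R -> R) :
  smooth2 F -> smooth2 G -> smooth2 u ->
  (forall x y, dy F x y = dx G x y) ->
  (forall x y, 0 < dx F x y) ->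
  (forall x y, dx F x y * dy G x y - dy F x y * dy F x y = 1) ->
  (forall x y, dy G x y * dx (dx u) x y - 2 * dy F x y * dy (dx u) x y
               + dx F x y * dy (dy u) x y = 0) ->
  (exists M, forall x y, Rabs (u x y) <= M) ->
  exists c, u = fun _ _ => c.
Proof.
intros HF HG Hu HFG Hr Hdet HL [M HM]; exists (u 0 0).
do 2 (apply functional_extensionality; intros ?).
apply Rle_antisym; eapply (Liouville_one_sided F G u M); assumption.
Qed.

(** * Jorgens' theorem *)

Lemma dx_dy g : smooth2 g -> dx (dy g) = dy (dx g).
Proof.
intros Hg; do 2 (apply functional_extensionality; intros ?).
now apply smooth2_schwarz.
Qed.

Lemma Jorgens (F G : R -> R -> R) :
  smooth2 F -> smooth2 G ->
  (forall x y, dy F x y = dx G x y) ->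
  (forall x y, 0 < dx F x y) ->
  (forall x y, dx F x y * dy G x y - dy F x y * dy F x y = 1) ->
  exists r s t : R,
    dx F = (fun _ _ => r) /\ dy F = (fun _ _ => s) /\ dy G = (fun _ _ => t).
Proof.
intros HF HG HFG Hr Hdet.
assert (EFG : dx G = dy F).
{ do 2 (apply functional_extensionality; intros ?); now rewrite HFG. }
assert (Hsr := smooth2_dx _ HF); assert (Hss := smooth2_dy _ HF).
assert (Hst := smooth2_dy _ HG).
assert (Ht : forall x y, 0 < dy G x y).
{ intros x y; specialize (Hr x y); specialize (Hdet x y); nra. }
set (N := fun x y => 2 + (dx F x y + dy G x y)).
assert (HN : forall x y, 0 < N x y).
{ intros x y; unfold N; specialize (Hr x y); specialize (Ht x y); lra. }
assert (HN' : forall x y, N x y <> 0) by (intros x y; apply Rgt_not_eq, HN).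
assert (HsN : smooth2 N).
{ unfold N; apply smooth2_plus; [apply smooth2_const|now apply smooth2_plus]. }
set (h1 := fun x y => (dy G x y - dx F x y) / N x y).
set (h2 := fun x y => (dy F x y + dy F x y) / N x y).
assert (Hs1 : smooth2 h1).
{ apply smooth2_div; [exact HN'|now apply smooth2_minus|exact HsN]. }
assert (Hs2 : smooth2 h2).
{ apply smooth2_div; [exact HN'|now apply smooth2_plus|exact HsN]. }
assert (Q1 : (fun x y => h1 x y * N x y) = fun x y => dy G x y - dx F x y).
{ do 2 (apply functional_extensionality; intros ?); unfold h1; field; apply HN'. }
assert (Q2 : (fun x y => h2 x y * N x y) = fun x y => dy F x y + dy F x y).
{ do 2 (apply functional_extensionality; intros ?); unfold h2; field; apply HN'. }
assert (Edet : (fun x y => dx F x y * dy G x y - dy F x y * dy F x y)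
               = fun _ _ => 1).
{ do 2 (apply functional_extensionality; intros ?); apply Hdet. }
assert (S1 := smooth2_mult _ _ Hsr Hst); assert (S2 := smooth2_mult _ _ Hss Hss).
assert (S3 := smooth2_const); assert (S4 := smooth2_plus _ _ Hsr Hst).
assert (Nx : dx N = fun x y => 0 + (dx (dx F) x y + dx (dy G) x y)).
{ unfold N; rewrite !dx_plus, dx_const by auto; reflexivity. }
assert (Ny : dy N = fun x y => 0 + (dy (dx F) x y + dy (dy G) x y)).
{ unfold N; rewrite !dy_plus, dy_const by auto; reflexivity. }
(* Cauchy-Riemann equations of [h1 + i h2] for the conformal structure of
   the metric [r dx^2 + 2 s dx dy + t dy^2]. *)
assert (CR : forall x y,
  dx h2 x y = dy F x y * dx h1 x y - dx F x y * dy h1 x y /\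
  dy h2 x y = dy G x y * dx h1 x y - dy F x y * dy h1 x y).
{ intros x y.
  assert (Q1x := f_equal (fun g => dx g x y) Q1).
  assert (Q1y := f_equal (fun g => dy g x y) Q1).
  assert (Q2x := f_equal (fun g => dx g x y) Q2).
  assert (Q2y := f_equal (fun g => dy g x y) Q2).
  assert (Ex := f_equal (fun g => dx g x y) Edet).
  assert (Ey := f_equal (fun g => dy g x y) Edet).
  cbv beta in Q1x, Q1y, Q2x, Q2y, Ex, Ey.
  rewrite dx_mult, dx_minus, Nx in Q1x by auto.
  rewrite dy_mult, dy_minus, Ny in Q1y by auto.
  rewrite dx_mult, dx_plus, Nx in Q2x by auto.
  rewrite dy_mult, dy_plus, Ny in Q2y by auto.
  rewrite dx_const, dx_minus, !dx_mult in Ex by auto.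
  rewrite dy_const, dy_minus, !dy_mult in Ey by auto.
  rewrite (dx_dy G HG), EFG, ?(dx_dy F HF) in *.
  change (h1 x y) with ((dy G x y - dx F x y) / N x y) in *.
  change (h2 x y) with ((dy F x y + dy F x y) / N x y) in *.
  specialize (HN x y); specialize (HN' x y).
  specialize (Hr x y); specialize (Hdet x y).
  change (N x y) with (2 + (dx F x y + dy G x y)) in *.
  revert Q1x Q1y Q2x Q2y Ex Ey Hr Hdet HN HN'.
  generalize (dx F x y) (dy F x y) (dy G x y) (dx (dx F) x y) (dy (dx F) x y)
    (dy (dy F) x y) (dy (dy G) x y) (dx h1 x y) (dy h1 x y)
    (dx h2 x y) (dy h2 x y).
  intros r s t rx sx sy ty h1x h1y h2x h2y; intros.
  (* The determinant equation and its two derivatives eliminate [t], [sy] and [ty]; the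
     Cauchy-Riemann equations become rational identities in [r], [s], [rx], [sx]. *)
  assert (Et : t = (1 + s * s) / r) by (field_simplify_eq; lra).
  assert (Esy : sy = (2 * s * sx - rx * t) / r) by (field_simplify_eq; lra).
  assert (Ety : ty = (2 * s * sy - sx * t) / r) by (field_simplify_eq; lra).
  set (n := 2 + (r + t)) in *.
  assert (H1x : h1x = ((sy - rx) - (t - r) / n * (0 + (rx + sy))) / n).
  { apply (Rmult_eq_reg_r n); [|exact HN'].
    transitivity ((sy - rx) - (t - r) / n * (0 + (rx + sy))); [lra|now field]. }
  assert (H1y : h1y = ((ty - sx) - (t - r) / n * (0 + (sx + ty))) / n).
  { apply (Rmult_eq_reg_r n); [|exact HN'].
    transitivity ((ty - sx) - (t - r) / n * (0 + (sx + ty))); [lra|now field]. }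
  assert (H2x : h2x = ((sx + sx) - (s + s) / n * (0 + (rx + sy))) / n).
  { apply (Rmult_eq_reg_r n); [|exact HN'].
    transitivity ((sx + sx) - (s + s) / n * (0 + (rx + sy))); [lra|now field]. }
  assert (H2y : h2y = ((sy + sy) - (s + s) / n * (0 + (sx + ty))) / n).
  { apply (Rmult_eq_reg_r n); [|exact HN'].
    transitivity ((sy + sy) - (s + s) / n * (0 + (sx + ty))); [lra|now field]. }
  clear Q1x Q1y Q2x Q2y Ex Ey Hdet.
  rewrite H1x, H1y, H2x, H2y; unfold n in *; rewrite Ety, Esy, Et.
  (* This is [r * n] after the elimination of [t], the denominator to be cleared. *)
  assert (0 < 2 * r + r * r + 1 + s * s) by nra.
  split; field; lra. }
assert (B : forall x y, Rabs (h1 x y) <= 1 /\ Rabs (h2 x y) <= 1).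
{ intros x y; unfold h1, h2.
  specialize (HN x y); specialize (Hr x y); specialize (Hdet x y).
  specialize (Ht x y).
  rewrite !Rabs_div by (apply Rgt_not_eq; exact HN).
  rewrite (Rabs_pos_eq (N x y)) by lra.
  split; apply Rle_div_l; try exact HN; unfold N; apply Rabs_le; [lra|].
  assert (Hsq : forall z r, 0 < r -> z * z < r * r -> - r <= z <= r).
  { intros z r Hr0 Hz; split; nra. }
  apply Hsq; [lra|].
  (* [(2 s)^2 = 4 r t - 4 < (r + t)^2 < N^2]. *)
  assert (P := Rle_0_sqr (dx F x y - dy G x y)); unfold Rsqr in P; lra. }
assert (C1 : exists c, h1 = fun _ _ => c).
{ apply (Liouville F G); try assumption; [|exists 1; apply B].
  intros x y.
  assert (D2x : dx h2 = fun x y => dy F x y * dx h1 x y - dx F x y * dy h1 x y).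
  { do 2 (apply functional_extensionality; intros ?); exact (proj1 (CR _ _)). }
  assert (D2y : dy h2 = fun x y => dy G x y * dx h1 x y - dy F x y * dy h1 x y).
  { do 2 (apply functional_extensionality; intros ?); exact (proj2 (CR _ _)). }
  assert (Hs1x := smooth2_dx _ Hs1); assert (Hs1y := smooth2_dy _ Hs1).
  (* Equality of the mixed derivatives of [h2], with [r_y = s_x] and [s_y = t_x], is exactly
     [L h1 = 0]. *)
  assert (E := smooth2_schwarz h2 Hs2 x y).
  rewrite D2x, D2y, dx_minus, dy_minus, !dx_mult, !dy_mult in E
    by (assumption || now apply smooth2_mult).
  rewrite (dx_dy G HG), EFG, (dx_dy F HF), (dx_dy h1 Hs1) in E.
  lra. }
destruct C1 as [c1 C1].
assert (Z : dx h2 = (fun _ _ => 0) /\ dy h2 = (fun _ _ => 0)).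
{ split; do 2 (apply functional_extensionality; intros ?);
    [rewrite (proj1 (CR _ _))|rewrite (proj2 (CR _ _))];
    rewrite C1, dx_const, dy_const; ring. }
destruct Z as [Zx Zy].
assert (C2 : exists c, h2 = fun _ _ => c).
{ apply (Liouville F G); try assumption; [|exists 1; apply B].
  intros x y; rewrite Zx, Zy, dx_const, !dy_const; ring. }
destruct C2 as [c2 C2].
(* |h1 + i h2|^2 = 1 - 4 / N *)
assert (K : forall x y, N x y * (1 - c1 * c1 - c2 * c2) = 4).
{ intros x y.
  assert (K1 := f_equal (fun g => g x y) C1).
  assert (K2 := f_equal (fun g => g x y) C2); cbv beta in K1, K2.
  rewrite <- K1, <- K2; unfold h1, h2.
  apply (Rmult_eq_reg_r (N x y)); [|apply HN'].
  transitivity (N x y * N x y - (dy G x y - dx F x y) * (dy G x y - dx F x y)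
                - 4 * (dy F x y * dy F x y)); [field; apply HN'|].
  specialize (Hdet x y); unfold N; lra. }
assert (KN : forall x y, N x y = N 0 0).
{ intros x y; apply (Rmult_eq_reg_r (1 - c1 * c1 - c2 * c2)).
  - now rewrite !K.
  - intros H; specialize (K 0 0); rewrite H in K; lra. }
assert (K1 : forall x y, dy G x y - dx F x y = c1 * N 0 0).
{ intros x y; assert (E := f_equal (fun g => g x y) Q1); cbv beta in E.
  now rewrite <- E, C1, KN. }
assert (K2 : forall x y, dy F x y + dy F x y = c2 * N 0 0).
{ intros x y; assert (E := f_equal (fun g => g x y) Q2); cbv beta in E.
  now rewrite <- E, C2, KN. }
unfold N in KN.
exists (dx F 0 0), (dy F 0 0), (dy G 0 0).
split; [|split]; apply functional_extensionality; intros x;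
  apply functional_extensionality; intros y;
  generalize (KN x y) (K1 x y) (K1 0 0) (K2 x y) (K2 0 0); lra.
Qed.

(** * Constant coefficients and bounded gradients *)

Lemma affine_of_constant_gradient g a b : smooth2 g ->
  dx g = (fun _ _ => a) -> dy g = (fun _ _ => b) ->
  forall x y, g x y = g 0 0 + a * x + b * y.
Proof.
intros Hg Ha Hb x y.
destruct (MVT_gen (fun t => g (0 + t * x) (0 + t * y)) 0 1
           (fun t => x * a + y * b)) as [c [_ Hc]].
- intros t _; assert (D := smooth2_line g Hg 0 0 x y t).
  now rewrite Ha, Hb in D.
- intros t _; apply derivable_continuous_pt, ex_derive_Reals_0.
  eexists; exact (smooth2_line g Hg 0 0 x y t).
- rewrite !Rmult_0_l, !Rplus_0_l, !Rmult_1_l in Hc; lra.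
Qed.

(** With constant coefficients the operator commutes with [dx] and [dy], so both partial derivatives
    of [k] are bounded solutions and Liouville's theorem makes them constant. *)
Lemma bounded_gradient_affine (F G k : R -> R -> R) (r s t B : R) :
  smooth2 F -> smooth2 G -> smooth2 k ->
  dx F = (fun _ _ => r) -> dy F = (fun _ _ => s) ->
  dx G = (fun _ _ => s) -> dy G = (fun _ _ => t) ->
  0 < r -> r * t - s * s = 1 ->
  (forall x y, t * dx (dx k) x y - 2 * s * dy (dx k) x y
               + r * dy (dy k) x y = 0) ->
  (forall x y, Rabs (dx k x y) <= B /\ Rabs (dy k x y) <= B) ->
  exists a b, forall x y, k x y = k 0 0 + a * x + b * y.
Proof.
intros HF HG Hk Fx Fy Gx Gy Hr Hdet HL HB.
assert (Hkx := smooth2_dx _ Hk); assert (Hky := smooth2_dy _ Hk).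
assert (Hkxx := smooth2_dx _ Hkx); assert (Hkxy := smooth2_dy _ Hkx).
assert (Hkyy := smooth2_dy _ Hky).
assert (C := smooth2_const).
assert (HL' : (fun x y => t * dx (dx k) x y - (2 * s) * dy (dx k) x y
                          + r * dy (dy k) x y) = fun _ _ => 0).
{ do 2 (apply functional_extensionality; intros ?); apply HL. }
assert (M1 := smooth2_mult _ _ (C t) Hkxx).
assert (M2 := smooth2_mult _ _ (C (2 * s)) Hkxy).
assert (M3 := smooth2_mult _ _ (C r) Hkyy).
assert (M4 := smooth2_minus _ _ M1 M2).
assert (Lx : exists a, dx k = fun _ _ => a).
{ apply (Liouville F G); rewrite ?Fx, ?Fy, ?Gx, ?Gy; try easy;
    [|exists B; intros x y; apply HB].
  intros x y; assert (E := f_equal (fun g => dx g x y) HL'); cbv beta in E.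
  rewrite dx_plus, dx_minus, !dx_mult, !dx_const in E by auto.
  rewrite (dx_dy _ Hkx), (dx_dy _ Hky), (dx_dy _ Hk) in E; lra. }
assert (Ly : exists b, dy k = fun _ _ => b).
{ apply (Liouville F G); rewrite ?Fx, ?Fy, ?Gx, ?Gy; try easy;
    [|exists B; intros x y; apply HB].
  intros x y; assert (E := f_equal (fun g => dy g x y) HL'); cbv beta in E.
  rewrite dy_plus, dy_minus, !dy_mult, !dy_const in E by auto.
  rewrite (dx_dy _ Hk), (dx_dy _ Hkx); lra. }
destruct Lx as [a Ha], Ly as [b Hb]; exists a, b.
now apply affine_of_constant_gradient.
Qed.

(** * Minimal graphs *)

Ltac solve_smooth2 :=
  repeat (assumption || apply smooth2_const || apply smooth2_minus
          || apply smooth2_plus || apply smooth2_mult).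

(* Differentiating [r W = 1 + |p|^2], [s W = <p, q>], [t W = 1 + |q|^2] and
   [W^2 = det], where [p = f_x] and [q = f_y], turns [r_y - s_x] into
   [<(F p - E q), M> / W^3] with [M] the left-hand side of the minimal surface
   system; likewise [s_y - t_x]. *)
Lemma minimal_metric_closed (f1 f2 W r s t : R -> R -> R) :
  smooth2 f1 -> smooth2 f2 ->
  smooth2 W -> smooth2 r -> smooth2 s -> smooth2 t ->
  minimal_graph f1 f2 ->
  (forall x y, 0 < W x y) ->
  (forall x y, r x y * W x y
               = 1 + (dx f1 x y * dx f1 x y + dx f2 x y * dx f2 x y)) ->
  (forall x y, s x y * W x y = dx f1 x y * dy f1 x y + dx f2 x y * dy f2 x y) ->
  (forall x y, t x y * W x y
               = 1 + (dy f1 x y * dy f1 x y + dy f2 x y * dy f2 x y)) ->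
  (forall x y, r x y * t x y - s x y * s x y = 1) ->
  forall x y, dy r x y = dx s x y /\ dy s x y = dx t x y.
Proof.
intros H1 H2 HW Hr Hs Ht Hmin HWp Er Es Et Hdet x y.
assert (H1x := smooth2_dx _ H1); assert (H1y := smooth2_dy _ H1).
assert (H2x := smooth2_dx _ H2); assert (H2y := smooth2_dy _ H2).
assert (Fext : forall g h : R -> R -> R, (forall x y, g x y = h x y) -> g = h).
{ intros g h H; do 2 (apply functional_extensionality; intros ?); apply H. }
assert (Rx := f_equal (fun g => dx g x y) (Fext _ _ Er)).
assert (Ry := f_equal (fun g => dy g x y) (Fext _ _ Er)).
assert (Sx := f_equal (fun g => dx g x y) (Fext _ _ Es)).
assert (Sy := f_equal (fun g => dy g x y) (Fext _ _ Es)).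
assert (Tx := f_equal (fun g => dx g x y) (Fext _ _ Et)).
assert (Ty := f_equal (fun g => dy g x y) (Fext _ _ Et)).
assert (Dx := f_equal (fun g => dx g x y) (Fext _ _ Hdet)).
assert (Dy := f_equal (fun g => dy g x y) (Fext _ _ Hdet)).
cbv beta in *.
rewrite !dx_plus, !dx_mult, dx_const in Rx by solve_smooth2.
rewrite !dy_plus, !dy_mult, dy_const in Ry by solve_smooth2.
rewrite dx_plus, !dx_mult in Sx by solve_smooth2.
rewrite dy_plus, !dy_mult in Sy by solve_smooth2.
rewrite !dx_plus, !dx_mult, dx_const in Tx by solve_smooth2.
rewrite !dy_plus, !dy_mult, dy_const in Ty by solve_smooth2.
rewrite dx_const, dx_minus, !dx_mult in Dx by solve_smooth2.
rewrite dy_const, dy_minus, !dy_mult in Dy by solve_smooth2.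
destruct (Hmin x y) as [E1 E2]; cbv zeta in E1, E2.
rewrite (dx_dy f1 H1), (dx_dy f2 H2) in *.
specialize (HWp x y); specialize (Er x y); specialize (Es x y).
specialize (Et x y); specialize (Hdet x y).
revert E1 E2 Rx Ry Sx Sy Tx Ty Dx Dy HWp Er Es Et Hdet.
generalize (dx (dx f1) x y) (dy (dx f1) x y) (dy (dy f1) x y)
  (dx (dx f2) x y) (dy (dx f2) x y) (dy (dy f2) x y)
  (dx f1 x y) (dy f1 x y) (dx f2 x y) (dy f2 x y)
  (dx r x y) (dy r x y) (dx s x y) (dy s x y) (dx t x y) (dy t x y)
  (dx W x y) (dy W x y) (r x y) (s x y) (t x y) (W x y).
clear; intros a1 b1 c1 a2 b2 c2 p1 q1 p2 q2 rx ry sx sy tx ty wx wy r s t w.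
intros.
assert (HD : (r * w) * (t * w) - (s * w) * (s * w) = w * w).
{ transitivity (w * w * (r * t - s * s)); [ring|rewrite Hdet; ring]. }
(* The derivative of [W^2 = (r W)(t W) - (s W)^2], kept in terms of the products so that each can be
   replaced by its polynomial in the derivatives of [f]. *)
assert (Wx : 2 * (w * wx) = (rx * w + r * wx) * (t * w)
               + (r * w) * (tx * w + t * wx) - 2 * (s * w) * (sx * w + s * wx)).
{ transitivity (w * w * (rx * t + r * tx - (sx * s + s * sx))
                + 2 * (w * wx) * (r * t - s * s)); [|ring].
  rewrite Dx, Hdet; ring. }
assert (Wy : 2 * (w * wy) = (ry * w + r * wy) * (t * w)
               + (r * w) * (ty * w + t * wy) - 2 * (s * w) * (sy * w + s * wy)).
{ transitivity (w * w * (ry * t + r * ty - (sy * s + s * sy))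
                + 2 * (w * wy) * (r * t - s * s)); [|ring].
  rewrite Dy, Hdet; ring. }
rewrite Rx, Tx, Sx, Er, Es, Et in Wx; rewrite Ry, Ty, Sy, Er, Es, Et in Wy.
assert (Hw3 : w * w * w <> 0) 
  by (apply Rgt_not_eq; repeat apply Rmult_lt_0_compat; assumption).
split.
- apply (Rmult_eq_reg_r (w * w * w)); [|exact Hw3].
  apply Rminus_diag_uniq.
  (* [(r_y - s_x) W^3] rewritten so that only derivatives of [r W], [s W] and [W^2] occur. *)
  transitivity (((ry * w + r * wy) - (sx * w + s * wx)) * (w * w)
                - (r * w) * (2 * (w * wy)) / 2 + (s * w) * (2 * (w * wx)) / 2);
    [field|].
  rewrite Ry, Sx, <- HD, Er, Es, Et, Wx, Wy.
  transitivity (((p1 * q1 + p2 * q2) * p1 - (1 + (p1 * p1 + p2 * p2)) * q1)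
      * ((1 + (q1 ^ 2 + q2 ^ 2)) * a1 - 2 * (p1 * q1 + p2 * q2) * b1
         + (1 + (p1 ^ 2 + p2 ^ 2)) * c1)
    + ((p1 * q1 + p2 * q2) * p2 - (1 + (p1 * p1 + p2 * p2)) * q2)
      * ((1 + (q1 ^ 2 + q2 ^ 2)) * a2 - 2 * (p1 * q1 + p2 * q2) * b2
         + (1 + (p1 ^ 2 + p2 ^ 2)) * c2)); [field|rewrite E1, E2; ring].
- apply (Rmult_eq_reg_r (w * w * w)); [|exact Hw3].
  apply Rminus_diag_uniq.
  transitivity (((sy * w + s * wy) - (tx * w + t * wx)) * (w * w)
                - (s * w) * (2 * (w * wy)) / 2 + (t * w) * (2 * (w * wx)) / 2);
    [field|].
  rewrite Sy, Tx, <- HD, Er, Es, Et, Wx, Wy.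
  (* Here the minimal surface system is paired with [(1 + |q|^2) p - <p, q> q]. *)
  transitivity (((1 + (q1 * q1 + q2 * q2)) * p1 - (p1 * q1 + p2 * q2) * q1)
      * ((1 + (q1 ^ 2 + q2 ^ 2)) * a1 - 2 * (p1 * q1 + p2 * q2) * b1
         + (1 + (p1 ^ 2 + p2 ^ 2)) * c1)
    + ((1 + (q1 * q1 + q2 * q2)) * p2 - (p1 * q1 + p2 * q2) * q2)
      * ((1 + (q1 ^ 2 + q2 ^ 2)) * a2 - 2 * (p1 * q1 + p2 * q2) * b2
         + (1 + (p1 ^ 2 + p2 ^ 2)) * c2)); [field|rewrite E1, E2; ring].
Qed.

Theorem theorem1p1 (f1 f2 : R -> R -> R) :
  smooth2 f1 -> smooth2 f2 ->
  minimal_graph f1 f2 ->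
  (exists M : R, forall x y, Rabs (jacobian f1 f2 x y) <= M) ->
  affine_2plane (graph f1 f2).
Proof.
intros H1 H2 Hmin [M HM].
assert (H1x := smooth2_dx _ H1); assert (H1y := smooth2_dy _ H1).
assert (H2x := smooth2_dx _ H2); assert (H2y := smooth2_dy _ H2).
set (a := fun x y => 1 + (dx f1 x y * dx f1 x y + dx f2 x y * dx f2 x y)).
set (b := fun x y => dx f1 x y * dy f1 x y + dx f2 x y * dy f2 x y).
set (c := fun x y => 1 + (dy f1 x y * dy f1 x y + dy f2 x y * dy f2 x y)).
assert (Ha : smooth2 a) by (unfold a; solve_smooth2).
assert (Hb : smooth2 b) by (unfold b; solve_smooth2).
assert (Hc : smooth2 c) by (unfold c; solve_smooth2).
(* Lagrange's identity [|p|^2 |q|^2 - <p, q>^2 = J^2], the point where the Jacobian enters. *)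
assert (ED : forall x y, a x y * c x y - b x y * b x y =
  a x y + c x y - 1 + jacobian f1 f2 x y * jacobian f1 f2 x y).
{ intros x y; unfold a, b, c, jacobian; ring. }
assert (Pa : forall x y, 1 <= a x y).
{ intros x y; unfold a.
  generalize (Rle_0_sqr (dx f1 x y)) (Rle_0_sqr (dx f2 x y)); unfold Rsqr; lra. }
assert (Pc : forall x y, 1 <= c x y).
{ intros x y; unfold c.
  generalize (Rle_0_sqr (dy f1 x y)) (Rle_0_sqr (dy f2 x y)); unfold Rsqr; lra. }
assert (PD : forall x y, 0 < a x y * c x y - b x y * b x y).
{ intros x y; rewrite ED.
  generalize (Rle_0_sqr (jacobian f1 f2 x y)) (Pa x y) (Pc x y).
  unfold Rsqr; lra. }
set (W := fun x y => sqrt (a x y * c x y - b x y * b x y)).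
assert (HW : smooth2 W) by (apply smooth2_sqrt; [exact PD|solve_smooth2]).
assert (PW : forall x y, 0 < W x y) by (intros x y; apply sqrt_lt_R0, PD).
assert (NW : forall x y, W x y <> 0) by (intros x y; apply Rgt_not_eq, PW).
assert (WW : forall x y, W x y * W x y = a x y * c x y - b x y * b x y).
{ intros x y; apply sqrt_sqrt, Rlt_le, PD. }
set (r := fun x y => a x y / W x y).
set (s := fun x y => b x y / W x y).
set (t := fun x y => c x y / W x y).
assert (Hr : smooth2 r) by now apply smooth2_div.
assert (Hs : smooth2 s) by now apply smooth2_div.
assert (Ht : smooth2 t) by now apply smooth2_div.
assert (Er : forall x y, r x y * W x y = a x y).
{ intros x y; unfold r; field; apply NW. }
assert (Es : forall x y, s x y * W x y = b x y).
{ intros x y; unfold s; field; apply NW. }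
assert (Et : forall x y, t x y * W x y = c x y).
{ intros x y; unfold t; field; apply NW. }
assert (Hdet : forall x y, r x y * t x y - s x y * s x y = 1).
{ intros x y; apply (Rmult_eq_reg_r (W x y * W x y)).
  - transitivity (r x y * W x y * (t x y * W x y)
                  - s x y * W x y * (s x y * W x y)); [ring|].
    rewrite Er, Es, Et, WW; ring.
  - apply Rgt_not_eq, Rmult_lt_0_compat; apply PW. }
assert (Hcl := minimal_metric_closed f1 f2 W r s t H1 H2 HW Hr Hs Ht Hmin PW
                 Er Es Et Hdet).
destruct (smooth2_potential r s Hr Hs) as [F [HF [Fx Fy]]]; [apply Hcl|].
destruct (smooth2_potential s t Hs Ht) as [G [HG [Gx Gy]]]; [apply Hcl|].
destruct (Jorgens F G HF HG) as [r0 [s0 [t0 [Cr [Cs Ct]]]]].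
{ intros x y; now rewrite Fy, Gx. }
{ intros x y; rewrite Fx; unfold r; apply Rdiv_lt_0_compat; [|apply PW].
  generalize (Pa x y); lra. }
{ intros x y; rewrite Fx, Fy, Gy; apply Hdet. }
rewrite Fx in Cr; rewrite Fy in Cs; rewrite Gy in Ct.
rewrite Cr in Er, Hdet, Fx; rewrite Cs in Es, Hdet, Fy, Gx.
rewrite Ct in Et, Hdet, Gy; clear r s t Hr Hs Ht Hcl Cr Cs Ct.
specialize (Hdet 0 0); cbv beta in *.
assert (Pr : 0 < r0) by (generalize (Er 0 0) (Pa 0 0) (PW 0 0); nra).
assert (Pt : 0 < t0) by nra.
(* From [W^2 = (r0 + t0) W - 1 + J^2]: if [W > L], then [W (W - r0 - t0)] exceeds [W (M^2 + 1)],
   which is more than [J^2 - 1] because [W > 1]. *)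
set (L := r0 + t0 + M * M + 1).
assert (BW : forall x y, W x y <= L).
{ intros x y; apply Rnot_lt_le; intros HL.
  assert (B := HM x y); apply Rabs_le_between in B.
  assert (BJ : jacobian f1 f2 x y * jacobian f1 f2 x y <= M * M) by nra.
  assert (E := WW x y); rewrite ED, <- Er, <- Et in E.
  unfold L in HL; assert (P := Rle_0_sqr M); unfold Rsqr in P.
  assert (W x y * (M * M + 1) < W x y * (W x y - (r0 + t0)))
    by (apply Rmult_lt_compat_l; [apply PW|lra]).
  nra. }
assert (Bsq : forall z k, z * z <= k -> Rabs z <= k + 1).
{ intros z k Hz; apply Rabs_le; split; nra. }
assert (Ba : forall x y, a x y <= (r0 + t0) * L).
{ intros x y; rewrite <- Er; generalize (BW x y) (PW x y); nra. }
assert (Bc : forall x y, c x y <= (r0 + t0) * L).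
{ intros x y; rewrite <- Et; generalize (BW x y) (PW x y); nra. }
(* Divided by [W], the minimal surface equation for each component has the constant coefficients
   [t0], [-2 s0], [r0]. *)
assert (Aff : forall k, smooth2 k ->
  (forall x y, c x y * dx (dx k) x y - 2 * b x y * dx (dy k) x y
               + a x y * dy (dy k) x y = 0) ->
  (forall x y, dx k x y * dx k x y <= a x y /\ dy k x y * dy k x y <= c x y) ->
  exists p q, forall x y, k x y = k 0 0 + p * x + q * y).
{ intros k Hk HL HB.
  apply (bounded_gradient_affine F G k r0 s0 t0 ((r0 + t0) * L + 1));
    try assumption.
  - intros x y; specialize (HL x y).
    rewrite <- Er, <- Es, <- Et, (dx_dy k Hk) in HL.
    apply (Rmult_eq_reg_r (W x y)); [lra|apply NW].
  - intros x y; specialize (HB x y); specialize (Ba x y); specialize (Bc x y).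
    split; apply Bsq; lra. }
assert (Sq : forall z, 0 <= z * z) by (intros z; apply Rle_0_sqr).
destruct (Aff f1 H1) as [p1 [q1 E1]].
{ intros x y; destruct (Hmin x y) as [E _].
  cbv zeta in E; unfold a, b, c; lra. }
{ intros x y; unfold a, c; generalize (Sq (dx f2 x y)) (Sq (dy f2 x y)); lra. }
destruct (Aff f2 H2) as [p2 [q2 E2]].
{ intros x y; destruct (Hmin x y) as [_ E].
  cbv zeta in E; unfold a, b, c; lra. }
{ intros x y; unfold a, c; generalize (Sq (dx f1 x y)) (Sq (dy f1 x y)); lra. }
(* The plane through [(0, 0, f(0, 0))] spanned by [(1, 0, p1, p2)] and [(0, 1, q1, q2)]; the first
   two coordinates already give independence. *)
exists 0, 0, (f1 0 0), (f2 0 0), 1, 0, p1, p2, 0, 1, q1, q2; split.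
- intros v w Hv Hw _ _; lra.
- intros [[[x y] z1] z2]; split.
  + intros [-> ->]; exists x, y; rewrite (E1 x y), (E2 x y).
    apply f_equal2; [apply f_equal2; [apply f_equal2|]|]; ring.
  + intros [v [w E]]; injection E; intros -> -> -> ->; split.
    * rewrite (E1 (0 + v * 1 + w * 0)); ring.
    * rewrite (E2 (0 + v * 1 + w * 0)); ring.
Qed.
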